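(* Let $\mathbb{F}$ be a field and let $\Xi\subset\mathbb{F}^2$ be an $x$-tower set, written as $\Xi=\{(\mathrm{x}(\sigma_j^x(i)),\mathrm{y}(j)):(i,j)\in S_x(\Xi)\}$ with $\mathrm{x},\mathrm{y},\sigma_j^x$ as in the definition of $x$-tower. For $(i,j)\in S_x(\Xi)$ set $$\phi_{ij}^x:=c_{ij}^x\prod_{t=0}^{j-1}(y-\mathrm{y}(t))\prod_{s=0}^{i-1}(x-\mathrm{x}(\sigma_j^x(s))),\qquad c_{ij}^x=\frac{1}{\prod_{t=0}^{j-1}(\mathrm{y}(j)-\mathrm{y}(t))\prod_{s=0}^{i-1}(\mathrm{x}(\sigma_j^x(i))-\mathrm{x}(\sigma_j^x(s)))}\in\mathbb{F},$$ where empty products are taken as $1$. Then for $(i,j),(m,n)\in S_x(\Xi)$ with $(i,j)\succeq_{\mathrm{inlex}}(m,n)$, we have $$\phi_{ij}^x(\mathrm{x}(\sigma_n^x(m)),\mathrm{y}(n))=\delta_{(i,j),(m,n)},$$ namely $\mathfrak{N}_{S_x(\Xi)}:=\{\phi_{ij}^x:(i,j)\in S_x(\Xi)\}$ forms a Newton interpolation basis for $\mathcal{P}_{\prec_{\mathrm{grlex}}}(\Xi)$.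
   Context: $\mathbb{N}_0$ is the set of nonnegative integers and $\Pi^2=\mathbb{F}[x,y]$. For a finite nonempty $\Xi\subset\mathbb{F}^2$, $\mathcal{I}(\Xi)\subset\Pi^2$ is the ideal of polynomials vanishing on $\Xi$. For a monomial order $\prec$, $\mathcal{N}_\prec(\mathcal{I}(\Xi))$ is the set of monomials not divisible by the leading monomial of any element of the reduced Gröbner basis of $\mathcal{I}(\Xi)$ w.r.t. $\prec$, and $\mathcal{P}_\prec(\Xi)=\mathrm{Span}_{\mathbb{F}}\mathcal{N}_\prec(\mathcal{I}(\Xi))$. Orders: $x^iy^j\prec_{\mathrm{grlex}}x^my^n$ iff $i+j<m+n$, or $i+j=m+n$ and $i<m$; $(i,j)\prec_{\mathrm{inlex}}(m,n)$ iff $j<n$, or $j=n$ and $i<m$. Newton interpolation basis: for nonzero polynomials $f,g\in\Pi^2$, write $f\prec g$ if the leading monomial of $f$ w.r.t. $\prec$ is $\prec$-smaller than that of $g$. Let $\Xi=\{\xi^{(0)},\xi^{(1)},\ldots,\xi^{(\mu-1)}\}\subset\mathbb{F}^2$ be a finite nonempty set of $\mu$ points and $\prec$ a fixed monomial order. If a subset $\{p_0,p_1,\ldots,p_{\mu-1}\}\subset\mathcal{P}_\prec(\Xi)$ with $p_0\prec p_1\prec\cdots\prec p_{\mu-1}$ satisfies $p_j(\xi^{(i)})=\delta_{ij}$ for $0\le i\le j\le\mu-1$, then it is called a Newton interpolation basis for $\mathcal{P}_\prec(\Xi)$. A finite nonempty $\mathcal{A}\subset\mathbb{N}_0^2$ is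 lower if $(i,j)\in\mathcal{A}$, $0\le i'\le i$, $0\le j'\le j$ imply $(i',j')\in\mathcal{A}$; $\mathrm{b}_x(\mathcal{A})=\max\{i:(i,0)\in\mathcal{A}\}$, $\mathrm{b}_y(\mathcal{A})=\max\{j:(0,j)\in\mathcal{A}\}$. For a nonincreasing sequence of nonnegative integers, $\mathrm{L}_x(m_0,\ldots,m_b)=\{(i,j):0\le j\le b,\ 0\le i\le m_j\}$. Every lower set can be written uniquely in this form; it is $x$-strict if $m_0,m_1,\ldots$ is strictly decreasing. $\pi_y$ is the projection onto the second coordinate. Let $\Xi_0^x,\ldots,\Xi_{\#\pi_y(\Xi)-1}^x$ be the sets $\Xi\cap\{y=\bar y\}$, $\bar y\in\pi_y(\Xi)$, enumerated with nonincreasing cardinalities, and put $S_x(\Xi)=\mathrm{L}_x(\#\Xi_0^x-1,\ldots,\#\Xi_{\#\pi_y(\Xi)-1}^x-1)$. A finite nonempty $\Xi\subset\mathbb{F}^2$ is $x$-tower if $S_x(\Xi)$ is $x$-strict and there are two injective functions $\mathrm{x},\mathrm{y}:\mathbb{N}_0\to\mathbb{F}$ and permutations $\sigma_0^x,\ldots,\sigma_{\mathrm{b}_y(S_x(\Xi))}^x$ of $\{0,1,\ldots,\mathrm{b}_x(S_x(\Xi))\}$ with $\Xi=\{(\mathrm{x}(\sigma_j^x(i)),\mathrm{y}(j)):(i,j)\in S_x(\Xi)\}$.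
   Formalization: The Newton basis lies in P_grlex(Ξ), but its elements are ordered by inlex leading monomials instead of grlex; with grlex for the chain the claim fails, e.g. for Ξ={(0,0),(1,0),(2,0),(2,1)}. *)

(* Defs.v *)
From HB Require Import structures.
From mathcomp Require Import all_boot all_order all_fingroup all_algebra.
From mathcomp Require Import finmap.
From mathcomp Require Import mpoly.

Set Implicit Arguments.
Unset Strict Implicit.
Unset Printing Implicit Defensive.

Import GRing.Theory.

Local Open Scope fset_scope.
Local Open Scope ring_scope.

(* Exponent pairs (i, j) stand for the monomials x^i y^j; the variables x and y
   of {mpoly F[2]} have index ord0 and ord_max. *)

Definition grlex (a b : nat * nat) : bool :=
  ((a.1 + a.2 < b.1 + b.2) || ((a.1 + a.2 == b.1 + b.2) && (a.1 < b.1)))%N.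

Definition inlex (a b : nat * nat) : bool :=
  ((a.2 < b.2) || ((a.2 == b.2) && (a.1 < b.1)))%N.

Definition mono (a : nat * nat) : 'X_{1..2} :=
  (U_(ord0) *+ a.1 + U_(ord_max) *+ a.2)%MM.

Definition mono_dvd (a b : nat * nat) : bool := (a.1 <= b.1)%N && (a.2 <= b.2)%N.

Definition eval2 (F : fieldType) (p : {mpoly F[2]}) (u : F * F) : F :=
  p.@[fun k : 'I_2 => if k == ord0 then u.1 else u.2].

Section Groebner.
Variables (F : fieldType) (lt : rel (nat * nat)).
Implicit Types (p q f g h : {mpoly F[2]}) (Xi : {fset F * F}).

(* lt is meant to be (the strict part of) a monomial order. The zero polynomial
   has no leading exponent, so that lt_poly p q entails p != 0 and q != 0. *)
Definition leading p (a : nat * nat) : Prop :=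
  mono a \in msupp p /\
  forall b, mono b \in msupp p -> b != a -> lt b a.

Definition lt_poly p q : Prop :=
  exists a b, [/\ leading p a, leading q b & lt a b].

Definition vanishing_ideal Xi p : Prop := forall u, u \in Xi -> eval2 p u = 0.

Definition groebner_basis (I : {mpoly F[2]} -> Prop) (G : {fset {mpoly F[2]}}) :
    Prop :=
  (forall g, g \in G -> I g /\ g != 0) /\
  (forall f, I f -> f != 0 ->
     exists g a b,
       [/\ g \in G, leading g a, leading f b & mono_dvd a b]).

Definition reduced_groebner_basis (I : {mpoly F[2]} -> Prop)
    (G : {fset {mpoly F[2]}}) : Prop :=
  [/\ groebner_basis I G,
      forall g a, g \in G -> leading g a -> g@_(mono a) = 1
    & forall g h a b, g \in G -> h \in G -> h != g -> leading h a ->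
        mono b \in msupp g -> ~~ mono_dvd a b].

(* N_lt(I): the reduced basis is unique, so the existential merely names it. *)
Definition normal_monomial (I : {mpoly F[2]} -> Prop) (b : nat * nat) : Prop :=
  exists G, reduced_groebner_basis I G /\
    forall g a, g \in G -> leading g a -> ~~ mono_dvd a b.

Definition normal_space Xi p : Prop :=
  exists (s : seq (nat * nat)) (c : nat * nat -> F),
    (forall a, a \in s -> normal_monomial (vanishing_ideal Xi) a) /\
    p = \sum_(a <- s) c a *: 'X_[mono a].

End Groebner.

(* N is a Newton interpolation basis for the space P_lts(Xi), its elements being
   ordered by their leading monomials with respect to lto.
   The usual notion is the case lts = lto. It has to be split here: the Newton
   condition for the basis of an x-tower set is triangular for inlex, whereas
   the interpolation space is the one of grlex. With lto = grlex the condition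
   can fail whatever the enumeration of the points: for
   Xi = {(0,0), (1,0), (2,0), (2,1)} one gets {1, y, x, x(x-1)/2}, in increasing
   grlex order, and the last polynomial takes the value 1 at two points. *)
Definition newton_basis (F : fieldType) (lts lto : rel (nat * nat))
    (Xi : {fset F * F}) (N : {fset {mpoly F[2]}}) : Prop :=
  exists (xi : 'I_#|` Xi| -> F * F) (p : 'I_#|` Xi| -> {mpoly F[2]}),
    [/\ Xi = [fset xi k | k : 'I_#|` Xi|],
        N = [fset p k | k : 'I_#|` Xi|],
        forall k, normal_space lts Xi (p k),
        forall k l : 'I_#|` Xi|, (k < l)%N -> lt_poly lto (p k) (p l)
      & forall i j : 'I_#|` Xi|, (i <= j)%N ->
          eval2 (p j) (xi i) = (i == j)%:R].

Definition bx (A : {fset nat * nat}) : nat := \max_(a <- A | a.2 == 0%N) a.1.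
Definition by_ (A : {fset nat * nat}) : nat := \max_(a <- A | a.1 == 0%N) a.2.

(* L_x(m_0, ..., m_b) for s = [:: m_0; ...; m_b] *)
Definition Lx (s : seq nat) : {fset nat * nat} :=
  [fset a in [seq (i, j) | j <- iota 0 (size s), i <- iota 0 (nth 0%N s j).+1]].

Definition x_strict (A : {fset nat * nat}) : Prop :=
  exists2 m : seq nat, A = Lx m & sorted gtn m.

Section Tower.
Variable F : fieldType.
Implicit Types Xi : {fset F * F}.

Definition y_fiber Xi (y0 : F) : {fset F * F} := [fset u in Xi | u.2 == y0].

Definition pi_y Xi : {fset F} := [fset u.2 | u in Xi].

(* S_x(Xi) depends only on the cardinalities of the fibers, so it suffices to sort
   these; fibers over pi_y Xi are nonempty, so .-1 is a genuine predecessor. *)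
Definition Sx Xi : {fset nat * nat} :=
  Lx [seq n.-1 | n <- sort geq [seq #|` y_fiber Xi y0| | y0 <- pi_y Xi]].

Section Repr.
Variables (Xi : {fset F * F}) (x y : nat -> F)
  (sigma : 'I_(by_ (Sx Xi)).+1 -> 'S_(bx (Sx Xi)).+1).

(* sigma_j(i) for natural numbers j <= b_y and i <= b_x; inord is the identity
   on values in this range, which contains all (i, j) in S_x(Xi). *)
Definition sig (j i : nat) : nat := sigma (inord j) (inord i).

Definition node (a : nat * nat) : F * F := (x (sig a.2 a.1), y a.2).

Definition x_tower_repr : Prop :=
  [/\ Xi != fset0, x_strict (Sx Xi), injective x, injective y
    & Xi = [fset node a | a in Sx Xi]].

Definition phi_coef (a : nat * nat) : F :=
  1 / ((\prod_(t < a.2) (y a.2 - y t)) *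
       \prod_(s < a.1) (x (sig a.2 a.1) - x (sig a.2 s))).

Definition phi (a : nat * nat) : {mpoly F[2]} :=
  phi_coef a *: ((\prod_(t < a.2) ('X_ord_max - (y t)%:MP)) *
                 \prod_(s < a.1) ('X_ord0 - (x (sig a.2 s))%:MP)).

End Repr.
End Tower.

(* Main.v *)
(* Let h j be the size of the j-th row of Xi, so that S_x(Xi) is the staircase
   {(i, j) : i < h j}, and h is strictly decreasing until it vanishes. The values
   at the nodes follow by inspection of the factors of phi. Since phi_a is a
   multiple of x^i y^j plus proper divisors of it, its inlex leading monomial is
   a and its support lies in S_x(Xi); it remains to see that S_x(Xi) is the set of
   grlex-normal monomials of the vanishing ideal.

   Interpolation on Xi by polynomials supported in the staircase is always
   possible, row by row, hence uniquely possible by counting. For the corner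
   (h j, j), interpolate x^(h j) on the rows j, j+1, ..., by polynomials supported
   in the staircase of these rows: by strictness that staircase has degree less
   than h j, so that x^(h j) minus the interpolant times prod_(t<j) (y - y t)
   vanishes on Xi and has grlex leading monomial (h j, j). Hence every monomial
   outside the staircase is a leading monomial of the ideal, and by uniqueness of
   interpolation no monomial inside is. Each corner monomial minus its normal
   form in the span of the staircase yields the reduced Groebner basis. *)

Require Import Defs.
From mathcomp Require Import all_boot all_order all_fingroup all_algebra.
From mathcomp Require Import finmap.
From mathcomp Require Import mpoly.
From mathcomp Require Import zify.

Set Implicit Arguments.
Unset Strict Implicit.
Unset Printing Implicit Defensive.

Import GRing.Theory.

Local Open Scope fset_scope.
Local Open Scope ring_scope.

(** * Exponent pairs, supports and evaluation of bivariate polynomials *)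

Definition expo (m : 'X_{1..2}) : nat * nat := (m ord0, m ord_max).

Lemma monoK : cancel mono expo.
Proof.
by case=> i j; rewrite /expo /mono !mnmDE !mulmnE !mnm1E /= !mul1n !mul0n addn0.
Qed.

Lemma expoK : cancel expo mono.
Proof.
move=> m; apply/mnmP => k; rewrite mnmDE !mulmnE !mnm1E /=.
case: k => -[|[|//]] k_lt; rewrite -!val_eqE /= ?mul0n ?mul1n ?addn0 ?add0n;
  by congr (m _); apply/val_inj.
Qed.

Definition addp (a b : nat * nat) : nat * nat := ((a.1 + b.1)%N, (a.2 + b.2)%N).

Lemma expoD m k : expo (m + k) = addp (expo m) (expo k).
Proof. by rewrite /expo /addp !mnmDE. Qed.

Lemma monoD a b : mono (addp a b) = (mono a + mono b)%MM.
Proof. by rewrite -[RHS]expoK expoD !monoK. Qed.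

Section Support.
Variable F : fieldType.
Implicit Types (A B : pred (nat * nat)) (p q : {mpoly F[2]}).

Definition supported A p := forall m, m \in msupp p -> A (expo m).

Lemma supported_coef A p a : supported A p -> ~~ A a -> p@_(mono a) = 0.
Proof.
by move=> Ap; apply: contraNeq; rewrite -mcoeff_msupp => /Ap; rewrite monoK.
Qed.

Lemma supported_sub A B p :
  (forall a, A a -> B a) -> supported A p -> supported B p.
Proof. by move=> AB Ap m /Ap/AB. Qed.

Lemma supported0 A : supported A 0.
Proof. by move=> m; rewrite msupp0. Qed.

Lemma supportedD A p q : supported A p -> supported A q -> supported A (p + q).
Proof.
by move=> Ap Aq m /msuppD_le; rewrite mem_cat => /orP[/Ap|/Aq].
Qed.

Lemma supportedZ A c p : supported A p -> supported A (c *: p).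
Proof. by move=> Ap m /msuppZ_le/Ap. Qed.

Lemma supportedN A p : supported A p -> supported A (- p).
Proof. by move=> Ap m; rewrite (perm_mem (msuppN p)) => /Ap. Qed.

Lemma supportedX A a : A a -> supported A 'X_[mono a].
Proof. by move=> Aa m; rewrite msuppX inE => /eqP->; rewrite monoK. Qed.

Lemma supportedM A B (C : pred (nat * nat)) p q :
    supported A p -> supported B q ->
  (forall a b, A a -> B b -> C (addp a b)) -> supported C (p * q).
Proof.
move=> Ap Bq ABC m /msuppM_le /allpairsP[[m1 m2] /= [/Ap A1 /Bq B2 ->]].
by rewrite expoD; apply: ABC.
Qed.

Lemma supported_expand (s : seq (nat * nat)) p :
  uniq s -> supported (fun a => a \in s) p ->
  p = \sum_(a <- s) p@_(mono a) *: 'X_[mono a].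
Proof.
move=> s_uniq sp; apply/mpolyP => m; rewrite raddf_sum /=.
under eq_bigr do rewrite mcoeffZ mcoeffX.
rewrite -[m]expoK; case: (boolP (expo m \in s)) => [ms|m_s].
  rewrite (bigD1_seq (expo m)) //= eqxx mulr1 big1 ?addr0 // => a a_neq.
  by rewrite (can_eq monoK) (negPf a_neq) mulr0.
rewrite (supported_coef sp m_s) big_seq big1 // => a sa; rewrite (can_eq monoK).
by case: eqP => [aE|]; rewrite ?mulr0 // -aE sa in m_s *.
Qed.

Lemma eval2D (u : F * F) p q : eval2 (p + q) u = eval2 p u + eval2 q u.
Proof. exact: mevalD. Qed.

Lemma eval2B (u : F * F) p q : eval2 (p - q) u = eval2 p u - eval2 q u.
Proof. exact: mevalB. Qed.

Lemma eval2M (u : F * F) p q : eval2 (p * q) u = eval2 p u * eval2 q u.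
Proof. exact: mevalM. Qed.

Lemma eval2Z (u : F * F) c p : eval2 (c *: p) u = c * eval2 p u.
Proof. exact: mevalZ. Qed.

Lemma eval2_sum (u : F * F) I (r : seq I) (P : pred I) (f : I -> {mpoly F[2]}) :
  eval2 (\sum_(i <- r | P i) f i) u = \sum_(i <- r | P i) eval2 (f i) u.
Proof. exact: raddf_sum. Qed.

Lemma eval2_prod (u : F * F) I (r : seq I) (P : pred I) (f : I -> {mpoly F[2]}) :
  eval2 (\prod_(i <- r | P i) f i) u = \prod_(i <- r | P i) eval2 (f i) u.
Proof. exact: rmorph_prod. Qed.

Lemma eval2_mono (u : F * F) a : eval2 'X_[mono a] u = u.1 ^+ a.1 * u.2 ^+ a.2.
Proof.
rewrite /eval2 mevalX big_ord_recl big_ord1 /=.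
have [-> <-] : (mono a ord0 = a.1 /\ mono a ord_max = a.2).
  by have := monoK a; rewrite /expo; case: a => i j /= [-> ->].
by rewrite (_ : lift _ _ = ord_max) //; apply: val_inj.
Qed.

Lemma eval2_x (u : F * F) c : eval2 ('X_ord0 - c%:MP) u = u.1 - c.
Proof. by rewrite eval2B /eval2 mevalXU mevalC. Qed.

Lemma eval2_y (u : F * F) c : eval2 ('X_ord_max - c%:MP) u = u.2 - c.
Proof. by rewrite eval2B /eval2 mevalXU mevalC. Qed.

End Support.

(** * Monic polynomials relative to a strict order on exponents *)

Section Monic.
Variables (F : fieldType) (lt : rel (nat * nat)).
Implicit Types (p q : {mpoly F[2]}).
Hypothesis lt_irr : irreflexive lt.
Hypothesis lt_trans : transitive lt.
Hypothesis lt_add : forall a b c, lt b a -> lt (addp b c) (addp a c).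

(** The relation [lt] need not be total: strict divisibility is a legitimate choice, and enlarging
    [lt] preserves the property. One computation of leading terms thus serves both [grlex] and
    [inlex]. *)
Definition monic_at a p := supported (lt^~ a) (p - 'X_[mono a]).

Lemma monic_at_supported a p :
  monic_at a p -> supported (fun b => (b == a) || lt b a) p.
Proof.
move=> ap; rewrite -(subrK 'X_[mono a] p); apply: supportedD.
  by apply: supported_sub ap => b ->; rewrite orbT.
by apply: supportedX; rewrite eqxx.
Qed.

Lemma monic_at_coef a p : monic_at a p -> p@_(mono a) = 1.
Proof.
move=> ap; have /eqP : (p - 'X_[mono a])@_(mono a) = 0.
  by apply: supported_coef ap _; rewrite lt_irr.
by rewrite mcoeffB mcoeffX eqxx subr_eq0 => /eqP.
Qed.

Lemma monic_at_leading a p : monic_at a p -> leading lt p a.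
Proof.
move=> ap; split; first by rewrite mcoeff_msupp (monic_at_coef ap) oner_eq0.
by move=> b /(monic_at_supported ap); rewrite monoK => /orP[->|].
Qed.

Lemma leadingZ a c p : c != 0 -> leading lt p a -> leading lt (c *: p) a.
Proof.
move=> c0 [ap lt_p]; split; first by rewrite (perm_mem (msuppZ _ c0)).
by move=> b; rewrite (perm_mem (msuppZ _ c0)); apply: lt_p.
Qed.

Lemma leading_inj p a b : leading lt p a -> leading lt p b -> a = b.
Proof.
move=> [ap lt_a] [bp lt_b]; apply/eqP/contraT => ab.
by have := lt_trans (lt_b _ ap ab) (lt_a _ bp _); rewrite lt_irr eq_sym; apply.
Qed.

Lemma monic_atX a : monic_at a 'X_[mono a].
Proof. by rewrite /monic_at subrr; apply: supported0. Qed.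

Lemma monic_atM a b p q :
  monic_at a p -> monic_at b q -> monic_at (addp a b) (p * q).
Proof.
move=> ap bq; have addpC c d : addp c d = addp d c.
  by rewrite /addp addnC [(_.2 + _)%N]addnC.
(* The difference of the two products telescopes into two summands, each containing one factor that
   is strictly below its leading exponent. *)
have -> : monic_at (addp a b) (p * q) =
  supported (lt^~ (addp a b))
    ((p - 'X_[mono a]) * q + 'X_[mono a] * (q - 'X_[mono b])).
  by rewrite /monic_at monoD mpolyXD mulrBl mulrBr subrKA.
apply: supportedD.
  apply: supportedM ap (monic_at_supported bq) _ => c d ca.
  case/orP=> [/eqP->|db]; first exact: lt_add.
  by apply: lt_trans (lt_add _ ca); rewrite ![addp c _]addpC; apply: lt_add.
apply: supportedM (supportedX (A := pred1 a) _) bq _; first by rewrite /= eqxx.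
by move=> c d /eqP-> db; rewrite ![addp a _]addpC; apply: lt_add.
Qed.

Lemma monic_at_prod (n : nat) (e : nat * nat) (f : nat -> {mpoly F[2]}) :
    (forall i, (i < n)%N -> monic_at e (f i)) ->
  monic_at ((n * e.1)%N, (n * e.2)%N) (\prod_(i < n) f i).
Proof.
elim: n => [|n IHn] ef.
  have := @monic_atX (0, 0)%N.
  by rewrite big_ord0 !mul0n -mpolyX0 /mono !mulm0n addm0.
rewrite big_ord_recr !mulSnr.
apply: (monic_atM (a := (_, _)) (b := e)) (IHn _) (ef _ _) => //.
by move=> i i_lt; apply/ef/ltnW.
Qed.

End Monic.

(** * Strict divisibility and the orders that refine it *)

Definition mono_sdvd (a b : nat * nat) : bool := mono_dvd a b && (a != b).

Lemma mono_sdvd_trans : transitive mono_sdvd.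
Proof.
by move=> [? ?] [? ?] [? ?]; rewrite /mono_sdvd /mono_dvd !xpair_eqE /=; lia.
Qed.

Lemma mono_sdvd_add a b c : mono_sdvd b a -> mono_sdvd (addp b c) (addp a c).
Proof.
move: a b c => [? ?] [? ?] [? ?].
by rewrite /mono_sdvd /mono_dvd !xpair_eqE /=; lia.
Qed.

Lemma grlex_irr : irreflexive grlex.
Proof. by move=> [? ?]; rewrite /grlex /=; lia. Qed.

Lemma grlex_trans : transitive grlex.
Proof. by move=> [? ?] [? ?] [? ?]; rewrite /grlex /=; lia. Qed.

Lemma grlex_add a b c : grlex b a -> grlex (addp b c) (addp a c).
Proof. by move: a b c => [? ?] [? ?] [? ?]; rewrite /grlex /=; lia. Qed.

Lemma inlex_irr : irreflexive inlex.
Proof. by move=> [? ?]; rewrite /inlex /=; lia. Qed.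

Lemma mono_sdvd_grlex a b : mono_sdvd a b -> grlex a b.
Proof.
move: a b => [? ?] [? ?].
by rewrite /mono_sdvd /mono_dvd /grlex !xpair_eqE /=; lia.
Qed.

Lemma mono_sdvd_inlex a b : mono_sdvd a b -> inlex a b.
Proof.
move: a b => [? ?] [? ?].
by rewrite /mono_sdvd /mono_dvd /inlex !xpair_eqE /=; lia.
Qed.

Lemma mpolyC_mono (F : fieldType) (c : F) :
  c%:MP = c *: 'X_[mono (0, 0)%N] :> {mpoly F[2]}.
Proof. by rewrite /mono !mulm0n addm0 mpolyX0 -mul_mpolyC mulr1. Qed.

Lemma monic_at_x (F : fieldType) (c : F) :
  monic_at mono_sdvd (1, 0)%N ('X_ord0 - c%:MP).
Proof.
have -> : U_(ord0)%MM = mono (1, 0)%N by rewrite /mono mulm1n mulm0n addm0.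
rewrite /monic_at mpolyC_mono addrAC subrr add0r.
exact/supportedN/supportedZ/supportedX.
Qed.

Lemma monic_at_y (F : fieldType) (c : F) :
  monic_at mono_sdvd (0, 1)%N ('X_ord_max - c%:MP).
Proof.
have -> : U_(ord_max)%MM = mono (0, 1)%N by rewrite /mono mulm1n mulm0n add0m.
rewrite /monic_at mpolyC_mono addrAC subrr add0r.
exact/supportedN/supportedZ/supportedX.
Qed.

(** * Products of linear factors in one variable *)

Section RowProducts.
Variable F : fieldType.
Implicit Types (X y : nat -> F).

Lemma monic_at_prod_x n X :
  monic_at mono_sdvd (n, 0)%N (\prod_(s < n) ('X_ord0 - (X s)%:MP)).
Proof.
have := monic_at_prod mono_sdvd_trans mono_sdvd_add
  (fun i _ => @monic_at_x F (X i)) (n := n).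
by rewrite /= muln1 muln0.
Qed.

Lemma monic_at_prod_y n y :
  monic_at mono_sdvd (0, n)%N (\prod_(t < n) ('X_ord_max - (y t)%:MP)).
Proof.
have := monic_at_prod mono_sdvd_trans mono_sdvd_add
  (fun i _ => @monic_at_y F (y i)) (n := n).
by rewrite /= muln1 muln0.
Qed.

Lemma eval2_prod_x n X u :
  eval2 (\prod_(s < n) ('X_ord0 - (X s)%:MP)) u = \prod_(s < n) (u.1 - X s).
Proof. by rewrite eval2_prod; apply: eq_bigr => s _; apply: eval2_x. Qed.

Lemma eval2_prod_y n y u :
  eval2 (\prod_(t < n) ('X_ord_max - (y t)%:MP)) u = \prod_(t < n) (u.2 - y t).
Proof. by rewrite eval2_prod; apply: eq_bigr => t _; apply: eval2_y. Qed.

Lemma prod_sub_eq0 n y (z : F) t :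
  (t < n)%N -> z = y t -> \prod_(t < n) (z - y t) = 0.
Proof. by move=> t_lt ->; rewrite (bigD1 (Ordinal t_lt)) //= subrr mul0r. Qed.

Lemma prod_sub_neq0 n y (z : F) :
  (forall t, (t < n)%N -> z != y t) -> \prod_(t < n) (z - y t) != 0.
Proof. by move=> zy; apply/prodf_neq0 => t _; rewrite subr_eq0 zy. Qed.

End RowProducts.

(** * Interpolation on a row and on a staircase of points *)

Definition inj_below (T : eqType) n (f : nat -> T) :=
  forall i j, (i < n)%N -> (j < n)%N -> f i = f j -> i = j.

Definition stair (h : nat -> nat) (a : nat * nat) : bool := (a.1 < h a.2)%N.

Section Interpolation.
Variable F : fieldType.

(** Newton interpolation in [x] alone: a new node is served by a multiple of the product that
    vanishes at all earlier nodes. The ordinate [z] only places the nodes in the plane. *)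
Lemma row_interp n (X v : nat -> F) (z : F) : inj_below n X ->
  exists2 P : {mpoly F[2]}, supported (fun a => (a.1 < n)%N && (a.2 == 0)%N) P
    & forall i, (i < n)%N -> eval2 P (X i, z) = v i.
Proof.
elim: n => [|n IHn] X_inj; first by exists 0 => //; apply: supported0.
have [|P suppP evalP] := IHn; first by move=> i j i_lt j_lt; apply: X_inj; lia.
pose Q : {mpoly F[2]} := \prod_(s < n) ('X_ord0 - (X s)%:MP).
pose c := (v n - eval2 P (X n, z)) / \prod_(s < n) (X n - X s).
exists (P + c *: Q).
  apply: supportedD; first by apply: supported_sub suppP => a; lia.
  apply/supportedZ/(supported_sub _ (monic_at_supported (@monic_at_prod_x _ _ _))).
  by move=> [i j]; rewrite /mono_sdvd /mono_dvd !xpair_eqE /=; lia.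
move=> i; rewrite ltnS leq_eqVlt eval2D eval2Z eval2_prod_x /=.
case/orP=> [/eqP->|i_lt].
  rewrite addrC divfK ?subrK ?prod_sub_neq0 // => t t_lt.
  by apply/eqP => /X_inj; lia.
by rewrite evalP // (prod_sub_eq0 i_lt) // mulr0 addr0.
Qed.

(** Induction on the number of rows. The bottom row is interpolated by [P] in [x] alone; the others
    are corrected by [y - y 0] times an interpolant [q] for the staircase without its bottom row.
    Multiplying by [y] shifts the support of [q] back into place, and the constant term keeps it
    inside because [h] is nonincreasing. *)
Lemma stair_interp b (h : nat -> nat) (X : nat -> nat -> F) (y : nat -> F)
    (v : nat -> nat -> F) :
    (forall j, (h j.+1 <= h j)%N) -> (forall j, (b <= j)%N -> h j = 0%N) ->
    inj_below b y -> (forall j, inj_below (h j) (X j)) ->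
  exists2 q : {mpoly F[2]}, supported (stair h) q
    & forall i j, (i < h j)%N -> eval2 q (X j i, y j) = v i j.
Proof.
elim: b h X y v => [|b IHb] h X y v h_noninc h_eq0 y_inj X_inj.
  by exists 0 => [|i j]; [apply: supported0|rewrite h_eq0].
have [P suppP evalP] := row_interp (v^~ 0%N) (y 0%N) (X_inj 0%N).
(* These divided differences are the values that [q] must take for the correction to be exact on the
   upper rows. *)
pose w i j := (v i j.+1 - eval2 P (X j.+1 i, y j.+1)) / (y j.+1 - y 0%N).
have [j|j||j|q suppq evalq] := IHb (h \o succn) (X \o succn) (y \o succn) w.
- exact: h_noninc.
- by move=> bj; apply: h_eq0.
- by move=> i k ib kb /y_inj; lia.
- exact: X_inj.
exists (P + ('X_ord_max - (y 0%N)%:MP) * q).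
  apply: supportedD.
    by apply: supported_sub suppP => -[i j] /= /andP[i_lt /eqP->].
  apply: supportedM (monic_at_supported (@monic_at_y F _)) suppq _.
  move=> [i1 j1] [i2 j2].
  rewrite /stair /mono_sdvd /mono_dvd !xpair_eqE /=.
  have := h_noninc j2; case: j1 => [|[|j1]]; rewrite ?add0n ?add1n; lia.
move=> i [|j] i_lt; rewrite eval2D eval2M eval2_y /=.
  by rewrite evalP // subrr mul0r addr0.
have j_lt : (j < b)%N by rewrite -ltnS ltnNge; apply/negP => /h_eq0; lia.
rewrite evalq //= mulrC addrC divfK ?subrK ?subr_eq0 //.
by apply/eqP => /y_inj; lia.
Qed.
End Interpolation.

(** * Existence of leading monomials for [grlex] *)

Lemma grlex_total a b : a != b -> grlex a b || grlex b a.
Proof. by move: a b => [? ?] [? ?]; rewrite /grlex xpair_eqE /=; lia. Qed.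

Lemma grlex_max (s : seq (nat * nat)) : s != [::] ->
  exists2 a, a \in s & forall c, c \in s -> c != a -> grlex c a.
Proof.
elim: s => // a [|b s] IHs _.
  by exists a => [|c]; rewrite inE // => ->.
have [//|d d_s d_max] := IHs.
have [ad|/negPf ad] := boolP ((a == d) || grlex a d).
  exists d => [|c]; rewrite inE ?d_s ?orbT // => /orP[/eqP->|/d_max//].
  by move/negPf=> ad'; rewrite ad' in ad.
have /norP[/grlex_total] := negbT ad; rewrite orbC => /orP[da _|->//].
exists a => [|c]; rewrite inE ?eqxx // => /orP[->//|cs] _.
by have [->//|/(d_max c cs)] := eqVneq c d; move=> /grlex_trans; apply.
Qed.

Lemma leading_exists (F : fieldType) (f : {mpoly F[2]}) :
  f != 0 -> exists a, leading grlex f a.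
Proof.
rewrite -msupp_eq0 => f_neq0; have [|a] := @grlex_max (map expo (msupp f)).
  by case: (msupp f) f_neq0.
move=> /mapP[m m_f ->] m_max; exists (expo m); split; first by rewrite expoK.
by move=> c /(map_f expo); rewrite monoK; apply: m_max.
Qed.

(** * The vanishing ideal of a strict staircase of points and its normal monomials *)

Section Staircase.
Variables (F : fieldType) (b : nat) (h : nat -> nat) (S : {fset nat * nat}).
Variables (X : nat -> nat -> F) (y : nat -> F).
Hypothesis h_dec : forall j, (j < b)%N -> (h j.+1 < h j)%N.
Hypothesis h_eq0 : forall j, (b <= j)%N -> h j = 0%N.
Hypothesis S_stair : forall a, (a \in S) = stair h a.
Hypothesis y_inj : inj_below b y.
Hypothesis X_inj : forall j, inj_below (h j) (X j).
Implicit Types (p q f : {mpoly F[2]}) (a c : nat * nat).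

Let pt a : F * F := (X a.2 a.1, y a.2).

Definition vanishing p := forall i j, (i < h j)%N -> eval2 p (X j i, y j) = 0.

Lemma h_noninc j : (h j.+1 <= h j)%N.
Proof. by case: (ltnP j b) => [/h_dec/ltnW|bj] //; rewrite !h_eq0 // leqW. Qed.

(** Each nonempty row is shorter by at least one than the row below it. Consequently the part of the
    staircase from row [j] upwards, moved down to row 0, has total degree less than [h j]; this is
    how strictness enters the comparison with [grlex]. *)
Lemma h_slope j k : (0 < h (j + k))%N -> (h (j + k) + k <= h j)%N.
Proof.
elim: k => [|k IHk]; rewrite ?addn0 // addnS => hjk.
have := IHk (leq_trans hjk (h_noninc _)).
have : (j + k < b)%N by rewrite ltnNge; apply/negP => /leqW/h_eq0; lia.
by move/h_dec; lia.
Qed.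

Lemma eval2_stair f u : supported (stair h) f ->
  eval2 f u = \sum_(k < size S) f@_(mono (nth (0, 0)%N S k)) *
                eval2 'X_[mono (nth (0, 0)%N S k)] u.
Proof.
move=> suppf; rewrite {1}(@supported_expand F S f) ?fset_uniq //.
  rewrite eval2_sum (big_nth (0, 0)%N) big_mkord.
  by apply: eq_bigr => k _; rewrite eval2Z.
by apply: supported_sub suppf => a; rewrite -S_stair.
Qed.

(** There are as many monomials as points, so the evaluation matrix is square; the existence of
    Lagrange polynomials gives it a one-sided inverse, which is then two-sided. *)
Lemma stair_unisolvent f : supported (stair h) f -> vanishing f -> f = 0.
Proof.
move=> suppf f_van; pose s k := nth (0, 0)%N S k.
have sS (k : 'I_(size S)) : stair h (s k) by rewrite -S_stair mem_nth.
have /fin_all_exists2[q suppq evalq] (k : 'I_(size S)) :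
    exists2 q, supported (stair h) q
      & forall l : 'I_(size S), eval2 q (pt (s l)) = (k == l)%:R.
  have [q suppq evalq] :=
    stair_interp (fun i j => (s k == (i, j))%:R) h_noninc h_eq0 y_inj X_inj.
  exists q => // l; rewrite evalq; last exact: sS.
  by rewrite -surjective_pairing nth_uniq ?fset_uniq.
(* The rows of [C] are the coefficients of the Lagrange polynomials, and [M] evaluates monomials at
   points; the Lagrange property reads [C *m M = 1]. *)
pose C := \matrix_(k < size S, l < size S) (q k)@_(mono (s l)).
pose M := \matrix_(l < size S, k < size S) eval2 'X_[mono (s l)] (pt (s k)).
have MC : M *m C = 1%:M.
  apply: mulmx1C; apply/matrixP => k l; rewrite !mxE -evalq eval2_stair //.
  by apply: eq_bigr => t _; rewrite !mxE.
pose r := \row_(l < size S) f@_(mono (s l)).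
have rM : r *m M = 0.
  apply/rowP => k; rewrite !mxE -[RHS](f_van (s k).1 (s k).2); last exact: sS.
  by rewrite eval2_stair //; apply: eq_bigr => t _; rewrite !mxE.
have r0 : r = 0 by rewrite -[r]mulmx1 -MC mulmxA rM mul0mx.
rewrite [f](@supported_expand F S) ?fset_uniq //; last first.
  by apply: supported_sub suppf => a; rewrite -S_stair.
rewrite (big_nth (0, 0)%N) big_mkord big1 // => k _.
by have /rowP/(_ k) := r0; rewrite !mxE => ->; rewrite scale0r.
Qed.

Lemma outside_monic a : ~~ stair h a ->
  exists2 p, vanishing p & monic_at grlex a p.
Proof.
case: a => i j; rewrite /stair -leqNgt /= => h_le.
(* From row [b] on, the product of [y - y t] over all [b] rows already vanishes at every point; a
   monomial factor brings its leading exponent to [(i, j)]. *)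
have [bj|jb] := leqP b j.
  exists ('X_[mono (i, j - b)%N] * \prod_(t < b) ('X_ord_max - (y t)%:MP)).
    move=> m n mn.
    rewrite eval2M eval2_prod_y /= (@prod_sub_eq0 _ _ _ _ n) ?mulr0 //.
    by rewrite ltnNge; apply/negP => /h_eq0; lia.
  apply: (@supported_sub _ (mono_sdvd^~ (i, j))) => [c|].
    exact: mono_sdvd_grlex.
  have -> : (i, j) = addp (i, j - b)%N (0, b)%N by rewrite /addp /= addn0 subnK.
  apply: monic_atM; [exact: mono_sdvd_trans|exact: mono_sdvd_add|..].
    exact: monic_atX.
  exact: monic_at_prod_y.
(* The rows below [j] will be killed by a product of [y - y t], so [x^(h j)] needs to be
   interpolated only on the rows from [j] on, reindexed from 0. *)
have [||||q suppq evalq] := @stair_interp F (b - j) (fun t => h (j + t)%N)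
    (fun t => X (j + t)%N) (fun t => y (j + t)%N)
    (fun s t => X (j + t)%N s ^+ h j).
- by move=> t; rewrite addnS h_noninc.
- by move=> t bt; rewrite h_eq0 //; lia.
- by move=> t t' tb t'b /y_inj; lia.
- by move=> t; apply: X_inj.
have monq : monic_at grlex (h j, 0)%N ('X_[mono (h j, 0)%N] - q).
  rewrite /monic_at addrAC subrr add0r; apply: supportedN.
  apply: supported_sub suppq => -[m n]; rewrite /stair /grlex /= => mn.
  have := @h_slope j n; lia.
exists ('X_[mono (i - h j, 0)%N] * (\prod_(t < j) ('X_ord_max - (y t)%:MP) *
         ('X_[mono (h j, 0)%N] - q))).
  move=> m n mn; rewrite !eval2M eval2_prod_y /=.
  have [nj|jn] := ltnP n j.
    by rewrite (@prod_sub_eq0 _ _ _ _ n) // mul0r mulr0.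
  rewrite eval2B; move: (evalq m (n - j)%N); rewrite subnKC // => -> //.
  by rewrite !eval2_mono /= !expr0 !mulr1 subrr !mulr0.
have -> : (i, j) = addp (i - h j, 0)%N (addp (0, j)%N (h j, 0)%N).
  by rewrite /addp /= addn0 add0n subnK.
apply: monic_atM; [exact: grlex_trans|exact: grlex_add|exact: monic_atX|].
apply: monic_atM; [exact: grlex_trans|exact: grlex_add| |exact: monq].
by apply: supported_sub (@monic_at_prod_y F j y) => a; apply: mono_sdvd_grlex.
Qed.

Lemma vanishing0 : vanishing 0.
Proof. by move=> i j _; apply: raddf0. Qed.

Lemma vanishingD p q : vanishing p -> vanishing q -> vanishing (p + q).
Proof. by move=> vp vq i j ij; rewrite eval2D vp ?vq ?addr0. Qed.

Lemma vanishingN p : vanishing p -> vanishing (- p).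
Proof.
by move=> vp i j ij; rewrite -[RHS]oppr0 -(vp i j ij); apply: raddfN.
Qed.

Lemma vanishingZ (d : F) p : vanishing p -> vanishing (d *: p).
Proof. by move=> vp i j ij; rewrite eval2Z vp ?mulr0. Qed.

(** Division with remainder by the polynomials of [outside_monic]: subtracting one of them from a
    monomial outside the staircase leaves only [grlex]-smaller terms, to which induction applies. *)
Lemma reduce_below a p : supported (grlex^~ a) p ->
  exists2 r, vanishing r & supported (fun c => stair h c && grlex c a) (p - r).
Proof.
(* [(a.1 + a.2) ^ 2 + a.1] is strictly increasing for grlex. *)
have [n] := ubnP ((a.1 + a.2) ^ 2 + a.1).
elim: n a p => // n IHn a p a_lt suppp.
rewrite [p]mpolyE big_seq.
pose Q g := exists2 r, vanishing r
  & supported (fun c => stair h c && grlex c a) (g - r).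
(* The claim is additive, so a single term of [p] suffices. *)
apply: (big_ind Q).
- by exists 0; [apply: vanishing0|rewrite subr0; apply: supported0].
- move=> g1 g2 [r1 van1 supp1] [r2 van2 supp2].
  exists (r1 + r2); first exact: vanishingD.
  by rewrite opprD addrACA; apply: supportedD.
move=> m /suppp; move: p@_m => d; rewrite -{2}[m]expoK; move: (expo m) => c ca.
suff [r van_r supp_r] : Q 'X_[mono c].
  by exists (d *: r); [apply: vanishingZ|rewrite -scalerBr; apply: supportedZ].
have [c_in|/outside_monic[g van_g mon_g]] := boolP (stair h c).
  exists 0; first exact: vanishing0.
  by rewrite subr0; apply: supportedX; rewrite c_in.
have [||r van_r supp_r] := IHn c ('X_[mono c] - g).
- by move: ca a_lt; rewrite /grlex; nia.
- by rewrite -opprB; apply: supportedN.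
exists (g + r); first exact: vanishingD.
rewrite opprD addrA; apply: supported_sub supp_r => e /andP[-> ec].
exact: grlex_trans ec ca.
Qed.

(** Reducing the whole tail into the staircase is what makes the Groebner basis built from the
    corners a reduced one. *)
Lemma outside_reduced a : ~~ stair h a ->
  exists2 r, vanishing r
    & supported (fun c => stair h c && grlex c a) (r - 'X_[mono a]).
Proof.
move=> /outside_monic[p van_p mon_p].
have [r van_r supp_r] := reduce_below mon_p.
exists (p - r); first exact/vanishingD/vanishingN.
by rewrite addrAC.
Qed.

(** If [a] were in the staircase, reducing the tail of [f] would give a vanishing polynomial
    supported in the staircase, hence zero; but its coefficient at [a] is still that of [f]. *)
Lemma vanishing_leading f a : vanishing f -> leading grlex f a -> ~~ stair h a.
Proof.
move=> van_f [fa lt_a]; apply/negP => a_in.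
pose g := f - f@_(mono a) *: 'X_[mono a].
have [|r van_r supp_r] := @reduce_below a g.
  move=> m; rewrite -{1}[m]expoK; move: (expo m) => c.
  rewrite mcoeff_msupp mcoeffB mcoeffZ mcoeffX (can_eq monoK).
  case: (eqVneq a c) => [->|ac]; first by rewrite mulr1 subrr eqxx.
  by rewrite mulr0 subr0 -mcoeff_msupp => /lt_a; apply; rewrite eq_sym.
have : f - r = 0.
  apply: stair_unisolvent; last exact/vanishingD/vanishingN.
  rewrite -(subrK (f@_(mono a) *: 'X_[mono a]) f) -/g addrAC.
  apply: supportedD; first by apply: supported_sub supp_r => c /andP[].
  exact/supportedZ/supportedX.
move/(congr1 (mcoeff (mono a))).
rewrite -(subrK (f@_(mono a) *: 'X_[mono a]) f) -/g addrAC mcoeffD mcoeff0.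
rewrite (supported_coef supp_r) ?grlex_irr ?andbF // add0r.
rewrite mcoeffZ mcoeffX eqxx mulr1.
by apply/eqP; rewrite -mcoeff_msupp.
Qed.

Lemma corner_ndvd k c : stair h c -> ~~ mono_dvd (h k, k) c.
Proof.
case: c => i j; rewrite /stair /mono_dvd /= => ij; apply/negP => /andP[hk kj].
by have := @h_slope k (j - k); rewrite subnKC //; lia.
Qed.

(** The bound on [j] matters: beyond row [b] every [(h j, j)] is [(0, j)], a multiple of the genuine
    corner [(0, b)]. *)
Lemma corners_ndvd j k : (j <= b)%N -> j != k -> ~~ mono_dvd (h k, k) (h j, j).
Proof.
move=> jb jk; apply/negP => /andP[/= hkj kj].
have kb : (k < b)%N by lia.
by have := @h_slope k (j - k); have := h_dec kb; rewrite subnKC //; lia.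
Qed.

Lemma stair_normal (I : {mpoly F[2]} -> Prop) a :
  (forall p, I p <-> vanishing p) -> stair h a -> normal_monomial grlex I a.
Proof.
move=> IE a_in.
have corner (k : 'I_b.+1) : ~~ stair h (h k, k : nat) by rewrite /stair ltnn.
have /fin_all_exists2[r van_r supp_r] (k : 'I_b.+1) :=
  outside_reduced (corner k).
have mon_r (k : 'I_b.+1) : monic_at grlex (h k, k : nat) (r k).
  by apply: supported_sub (supp_r k) => c /andP[].
have lead_r (k : 'I_b.+1) := monic_at_leading grlex_irr (mon_r k).
have r_lead (k : 'I_b.+1) c : leading grlex (r k) c -> c = (h k, k : nat).
  by move=> rc; have := leading_inj grlex_irr grlex_trans rc (lead_r k).
(* One generator per corner: the [b] nonempty rows, and the corner [(0, b)] on top of them. *)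
exists [fset r k | k : 'I_b.+1]; split; last first.
  by move=> _ c /imfsetP[k _ ->] /r_lead->; apply: corner_ndvd.
split; last 2 first.
- move=> _ c /imfsetP[k _ ->] /r_lead->.
  by rewrite (monic_at_coef grlex_irr (mon_r k)).
- move=> _ _ c d /imfsetP[j _ ->] /imfsetP[k _ ->] r_neq /r_lead-> rd.
  (* A monomial of [r j] is either its own corner or a point of the staircase, and neither is
     divisible by another corner. *)
  have : supported (fun e => (e == (h j, j : nat)) || stair h e) (r j).
    rewrite -(subrK 'X_[mono (h j, j : nat)] (r j)); apply: supportedD.
      by apply: supported_sub (supp_r j) => e /andP[->]; rewrite orbT.
    by apply: supportedX; rewrite eqxx.
  move=> /(_ _ rd); rewrite monoK => /orP[/eqP->|]; last exact: corner_ndvd.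
  apply: corners_ndvd; first by rewrite -ltnS.
  by apply: contraNneq r_neq => /val_inj->.
split=> [_ /imfsetP[k _ ->]|f /IE van_f f_neq0].
  split; first exact/IE/van_r.
  by apply: contraTneq (lead_r k).1 => ->; rewrite msupp0.
have [c lead_c] := leading_exists f_neq0.
have := vanishing_leading van_f lead_c; rewrite /stair -leqNgt => c_out.
(* Row [c.2] supplies the dividing corner; above row [b] the corner [(0, b)] takes over, whence the
   truncation. *)
have kb : (minn c.2 b < b.+1)%N by rewrite ltnS geq_minr.
exists (r (Ordinal kb)), (h (minn c.2 b), minn c.2 b), c; split => //.
  exact: in_imfset.
rewrite /mono_dvd /= geq_minl andbT.
by case: (leqP c.2 b) c_out => // _ _; rewrite h_eq0.
Qed.

End Staircase.

(** * Staircases given by sequences, and sorting by [inlex] *)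

Definition height (m : seq nat) (j : nat) : nat := nth 0%N (map succn m) j.

Lemma height_dec m j : sorted gtn m -> (j < size m)%N ->
  (height m j.+1 < height m j)%N.
Proof.
move=> /(sorted_ltn_nth (rev_trans ltn_trans)) m_dec jm.
(* The last row drops to the default 0, strictly, because [succn] makes every listed height
   positive. *)
have [j1m|mj1] := ltnP j.+1 (size m).
  by rewrite /height !(nth_map 0%N) // ltnS (m_dec 0%N j j.+1).
by rewrite /height nth_default ?size_map // (nth_map 0%N).
Qed.

Lemma height_eq0 m j : (size m <= j)%N -> height m j = 0%N.
Proof. by move=> mj; rewrite /height nth_default ?size_map. Qed.

Lemma mem_Lx m a : (a \in Lx m) = stair (height m) a.
Proof.
rewrite in_fset /stair; apply/allpairsPdep/idP => [[j [i []]]|a_lt].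
  by rewrite !mem_iota !add0n => jm ij ->; rewrite /height (nth_map 0%N).
have jm : (a.2 < size m)%N.
  by rewrite ltnNge; apply: contraTN a_lt => /height_eq0->.
exists a.2, a.1; rewrite !mem_iota !add0n -surjective_pairing; split=> //.
by move: a_lt; rewrite /height (nth_map 0%N).
Qed.

Lemma stair_lower h a c : (forall j, h j.+1 <= h j)%N ->
  stair h a -> mono_dvd c a -> stair h c.
Proof.
move=> h_noninc; case: a c => [i j] [k l]; rewrite /stair /mono_dvd /= => ij.
case/andP=> ki lj; apply: (leq_ltn_trans ki); apply: (leq_trans ij).
rewrite -(subnK lj); elim: (j - l)%N => // n IHn.
by rewrite addSn; apply: leq_trans (h_noninc _) IHn.
Qed.

Definition leinlex (a b : nat * nat) := (a == b) || inlex a b.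

Lemma leinlex_trans : transitive leinlex.
Proof.
by move=> [? ?] [? ?] [? ?]; rewrite /leinlex /inlex !xpair_eqE /=; lia.
Qed.

Lemma leinlex_total : total leinlex.
Proof. by move=> [? ?] [? ?]; rewrite /leinlex /inlex !xpair_eqE /=; lia. Qed.

Lemma imfset_nth (T U : choiceType) (f : T -> U) (A : {fset T}) (s : seq T) x0 n :
  size s = n -> s =i A ->
  [fset f a | a in A] = [fset f (nth x0 s (nat_of_ord k)) | k : 'I_n].
Proof.
move=> sn sA; apply/fsetP => u; apply/imfsetP/imfsetP => /= -[a aA ->].
  have a_s : (index a s < n)%N by rewrite -sn index_mem sA.
  by exists (Ordinal a_s); rewrite //= nth_index ?sA.
by exists (nth x0 s a); rewrite // -sA mem_nth ?sn.
Qed.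

(** * The Newton basis of an x-tower set *)

Section Tower.
Variables (F : fieldType) (Xi : {fset F * F}) (x y : nat -> F).
Variable (sigma : 'I_(by_ (Sx Xi)).+1 -> 'S_(bx (Sx Xi)).+1).
Hypothesis repr : x_tower_repr x y sigma.

Let A := Sx Xi.
Let X j i := x (sig sigma j i).

Lemma Sx_stair : exists b h, [/\ forall j, (j < b)%N -> (h j.+1 < h j)%N,
  forall j, (b <= j)%N -> h j = 0%N & forall a, (a \in A) = stair h a].
Proof.
have [_ [m Am m_dec] _ _ _] := repr; exists (size m), (height m); split.
- by move=> j; apply: height_dec.
- by move=> j; apply: height_eq0.
- by move=> a; rewrite /A Am mem_Lx.
Qed.

Lemma Sx_lower a c : a \in A -> mono_dvd c a -> c \in A.
Proof.
have [b [h [h_dec h_eq0 AE]]] := Sx_stair; rewrite !AE.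
exact/stair_lower/(h_noninc h_dec h_eq0).
Qed.

(** As [bx] looks only at the bottom row, lowerness is used to project [a] there. The bound makes
    [inord] faithful on every abscissa index that occurs. *)
Lemma Sx_bound_x a : a \in A -> (a.1 < (bx A).+1)%N.
Proof.
move=> aA; rewrite ltnS (@leq_bigmax_seq _ _ _ _ (a.1, 0)%N) //.
by apply: Sx_lower aA _; rewrite /mono_dvd leqnn.
Qed.

Lemma X_inj_row a : a \in A -> forall k, (k < a.1)%N -> X a.2 a.1 != X a.2 k.
Proof.
move=> aA k ka; have [_ _ x_inj _ _] := repr.
have a_lt := Sx_bound_x aA; have k_lt := ltn_trans ka a_lt.
apply/eqP => /x_inj/val_inj/perm_inj/(congr1 val).
by rewrite /= !inordK // => ak; rewrite ak ltnn in ka.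
Qed.

Lemma X_inj_rows h : (forall a, (a \in A) = stair h a) ->
  forall j, inj_below (h j) (X j).
Proof.
move=> AE j i k ij kj ik; apply/eqP; case: ltngtP => // [ltik|ltki].
  by have := @X_inj_row (k, j); rewrite AE => /(_ kj i ltik); rewrite /= ik eqxx.
by have := @X_inj_row (i, j); rewrite AE => /(_ ij k ltki); rewrite /= ik eqxx.
Qed.

Lemma phi_den_neq0 a : a \in A ->
  (\prod_(t < a.2) (y a.2 - y t)) * \prod_(s < a.1) (X a.2 a.1 - X a.2 s) != 0.
Proof.
move=> aA; have [_ _ _ y_inj _] := repr.
rewrite mulf_neq0 ?prod_sub_neq0 //; last exact: X_inj_row.
by move=> t ta; apply/eqP => /y_inj at_; rewrite at_ ltnn in ta.
Qed.

Lemma phi_monic a :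
  monic_at mono_sdvd a ((\prod_(t < a.2) ('X_ord_max - (y t)%:MP)) *
                        \prod_(s < a.1) ('X_ord0 - (X a.2 s)%:MP)).
Proof.
have {1}-> : a = addp (0, a.2)%N (a.1, 0)%N.
  by case: a => i j; rewrite /addp /= addn0.
apply: monic_atM; [exact: mono_sdvd_trans|exact: mono_sdvd_add|..].
  exact: monic_at_prod_y.
exact: monic_at_prod_x.
Qed.

Lemma phi_leading a (lt : rel (nat * nat)) : irreflexive lt ->
  (forall c d, mono_sdvd c d -> lt c d) -> a \in A ->
  leading lt (phi x y sigma a) a.
Proof.
move=> lt_irr lt_dvd aA; apply: leadingZ.
  by rewrite /phi_coef div1r invr_neq0 ?phi_den_neq0.
apply/monic_at_leading => //; apply: supported_sub (fun c => lt_dvd c a) _.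
exact: phi_monic.
Qed.

Lemma phi_supported a :
  a \in A -> supported (fun c => c \in A) (phi x y sigma a).
Proof.
move=> aA; apply/supportedZ.
apply: supported_sub (monic_at_supported (@phi_monic a)) => c.
by case/orP=> [/eqP->|/andP[ca _]] //; apply: Sx_lower aA ca.
Qed.

(** For [b] strictly below [a], a node in an earlier row is a zero of the product in [y], and an
    earlier node in the same row is a zero of the product in [x]. For [b = a] the coefficient
    normalizes the value. *)
Lemma eval_phi a b : a \in A -> leinlex b a ->
  eval2 (phi x y sigma a) (node x y sigma b) = (a == b)%:R.
Proof.
move=> aA; rewrite eval2Z eval2M (eval2_prod_x a.1 (X a.2)) eval2_prod_y /=.
have [<- _|ab] := eqVneq a b.
  by rewrite /phi_coef div1r mulVf ?phi_den_neq0.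
rewrite /leinlex eq_sym (negPf ab) /= => /orP[b2|/andP[/eqP b2 b1]].
  by rewrite (@prod_sub_eq0 _ _ _ _ b.2) // mul0r mulr0.
by rewrite b2 (@prod_sub_eq0 _ _ (X a.2) _ b.1) ?b2 // !mulr0.
Qed.

(** Needed to identify the number of points of [Xi] with that of [A], so that the points and the
    polynomials share one index type. *)
Lemma node_inj : {in A &, injective (node x y sigma)}.
Proof.
have [_ _ _ y_inj _] := repr; have [b [h [_ _ AE]]] := Sx_stair.
move=> [i j] [k l]; rewrite !AE => ij kl [xE /y_inj lj]; subst l.
by have /= -> := X_inj_rows AE ij kl xE.
Qed.

Lemma phi_normal a : a \in A -> normal_space grlex Xi (phi x y sigma a).
Proof.
move=> aA; have [_ _ _ y_inj XiE] := repr.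
exists A, (fun c => (phi x y sigma a)@_(mono c)); split; last first.
  by apply: supported_expand (phi_supported aA); apply: fset_uniq.
have [b [h [h_dec h_eq0 AE]]] := Sx_stair.
move=> c; rewrite AE; have yb_inj : inj_below b y by move=> i j _ _ /y_inj.
apply: (stair_normal h_dec h_eq0 AE yb_inj (X_inj_rows AE)).
move=> p; split=> [p0 i j ij|p0 u].
  by apply: p0; rewrite XiE; apply/imfsetP; exists (i, j); rewrite //= AE.
by rewrite XiE => /imfsetP[[i j] /=]; rewrite AE => /p0 pij ->.
Qed.

Lemma phi_newton :
  newton_basis grlex inlex Xi [fset phi x y sigma a | a in A].
Proof.
have [_ _ _ _ XiE] := repr.
(* Sorting the index set by [inlex] enumerates points and polynomials simultaneously, in the order
   for which the values are triangular. *)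
pose s := sort leinlex A; pose a_ k := nth (0, 0)%N s k.
have s_mem : s =i A by move=> a; rewrite mem_sort.
have s_size : size s = #|` Xi|.
  rewrite size_sort; rewrite [in RHS]XiE; apply/esym.
  by rewrite card_in_imfset //; apply: node_inj.
have s_uniq : uniq s by rewrite sort_uniq fset_uniq.
have a_mem (k : 'I_#|` Xi|) : a_ k \in A by rewrite -s_mem mem_nth ?s_size.
have a_le (k l : 'I_#|` Xi|) : (k <= l)%N -> leinlex (a_ k) (a_ l).
  move=> kl.
  apply: (sorted_leq_nth leinlex_trans) => //; rewrite ?inE ?s_size //.
    by move=> a; rewrite /leinlex eqxx.
  exact: sort_sorted leinlex_total _.
have a_eq (k l : 'I_#|` Xi|) : (a_ k == a_ l) = (k == l).
  by rewrite nth_uniq ?s_size.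
exists (fun k => node x y sigma (a_ k)), (fun k => phi x y sigma (a_ k)); split.
- by rewrite {1}XiE; apply: imfset_nth.
- exact: imfset_nth.
- by move=> k; apply: phi_normal.
- move=> k l kl; exists (a_ k), (a_ l).
  split; [exact: phi_leading inlex_irr mono_sdvd_inlex (a_mem _)..|].
  have := a_le k l (ltnW kl); rewrite /leinlex a_eq => /orP[/eqP kl'|//].
  by rewrite kl' ltnn in kl.
- by move=> k l kl; rewrite eval_phi ?a_le // a_eq eq_sym.
Qed.

End Tower.

Theorem theorem3p2 (F : fieldType) (Xi : {fset F * F}) (x y : nat -> F)
    (sigma : 'I_(by_ (Sx Xi)).+1 -> 'S_(bx (Sx Xi)).+1) :
  x_tower_repr x y sigma ->
  (forall a b : nat * nat, a \in Sx Xi -> b \in Sx Xi ->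
     (b == a) || inlex b a ->
     eval2 (phi x y sigma a) (node x y sigma b) = (a == b)%:R) /\
  newton_basis grlex inlex Xi [fset phi x y sigma a | a in Sx Xi].
Proof.
move=> repr; split; last exact: phi_newton.
by move=> a b aA _; apply: eval_phi.
Qed.
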